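(* Let $(M,\mathcal F)$ be a 4-dimensional pseudo-Finsler space, let $L_1=L_1(x,y)$ be a function, smooth for $y\neq 0$ and 1-homogeneous in $y$, and let $A_i=\dfrac{\partial L_1}{\partial y^i}$. Let $F$ be the electromagnetic tensor, i.e. the 2-form $$F=\tfrac12F_{ij}\,dx^i\wedge dx^j+\tilde F_{ia}\,dx^i\wedge\delta y^a,\qquad F_{ij}=A_{j|i}-A_{i|j},\quad \tilde F_{ia}=-\frac{\partial A_i}{\partial y^a}.$$ Then the generalized homogeneous Maxwell equation holds: $$dF=0,$$ where $d$ denotes the exterior derivative.
   Context: All indices run over $1,\dots,4$, with summation over repeated indices. $M$ is a $\mathcal C^\infty$ 4-dimensional manifold and $(x^i,y^i)$ are local coordinates on $TM$ induced by a chart of $M$. A pseudo-Finslerian function on $M$ is a function $\mathcal F:TM\to\mathbb R$ that is smooth for $y\ne0$, satisfies $\mathcal F(x,\lambda y)=\lambda\mathcal F(x,y)$ for $\lambda>0$, and whose metric tensor $g_{ij}(x,y)=\frac12\frac{\partial^2\mathcal F^2}{\partial y^i\partial y^j}$ is nondegenerate for all $y\neq0$; $(g^{ij})$ is the inverse matrix of $(g_{ij})$. All objects are considered on the part of $TM$ where $y\neq 0$. The geodesic equations of $(M,\mathcal F)$ (Euler–Lagrange equations of $\frac12\mathcal F^2$) are written $\frac{dy^i}{ds}+2G^i(x,y)=0$, $y^i=\dot x^i$, i.e. $G^i=\frac14 g^{ih}\big(\frac{\partial^2\mathcal F^2}{\partial y^h\partial x^k}y^k-\frac{\partial \mathcal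 F^2}{\partial x^h}\big)$. The Cartan nonlinear connection has coefficients $N^i_{\ j}=\partial G^i/\partial y^j$. Put $\delta_i=\frac{\partial}{\partial x^i}-N^a_{\ i}\frac{\partial}{\partial y^a}$ and $\delta y^a=dy^a+N^a_{\ i}dx^i$. The Chern connection has coefficients $L^i_{\ jk}=\frac12g^{ih}(\delta_kg_{hj}+\delta_jg_{hk}-\delta_hg_{jk})$, and $A_{j|i}=\delta_iA_j-L^k_{\ ji}A_k$. A function $L_1(x,y)$ is 1-homogeneous in $y$ if $\frac{\partial L_1}{\partial y^i}y^i=L_1$ (for $y\neq 0$). *)

(* Defs.v *)
From HB Require Import structures.
From mathcomp Require Import all_boot all_order all_algebra.
From mathcomp Require Import all_classical all_reals all_analysis.

Set Implicit Arguments.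
Unset Strict Implicit.
Unset Printing Implicit Defensive.

Import Order.TTheory GRing.Theory Num.Theory numFieldNormedType.Exports.
Local Open Scope classical_set_scope.
Local Open Scope ring_scope.

Section Smoothness.
Context {R : realType} {V W : normedModType R}.

(* Meant for an open U and a finite-dimensional V, where a differentiable f is
   of class C^(k+1) iff each of its directional derivatives is of class C^k. *)
Fixpoint Ck_on (k : nat) (U : set V) (f : V -> W) : Prop :=
  if k is k'.+1 then
    (forall x, U x -> differentiable f x) /\ (forall v, Ck_on k' U ('D_v f))
  else forall x, U x -> {for x, continuous f}.

Definition smooth_on (U : set V) (f : V -> W) : Prop := forall k, Ck_on k U f.

End Smoothness.

(* The family of charts is any smooth atlas, possibly the maximal one; param c
   matters only on the open set coord c @` dom c, where it inverts coord c. *)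
Record manifold (R : realType) (n : nat) := Manifold {
  point :> topologicalType;
  chart : Type;
  dom : chart -> set point;
  coord : chart -> point -> 'rV[R]_n;
  param : chart -> 'rV[R]_n -> point;
  point_hausdorff : hausdorff_space point;
  point_second_countable : @second_countable point;
  dom_cover : forall p, exists c, dom c p;
  dom_open : forall c, open (dom c);
  range_open : forall c, open (coord c @` dom c);
  coordK : forall c p, dom c p -> param c (coord c p) = p;
  coord_continuous : forall c p, dom c p -> {for p, continuous (coord c)};
  param_continuous : forall c x,
    (coord c @` dom c) x -> {for x, continuous (param c)};
  transition_smooth : forall c d,
    smooth_on (coord c @` (dom c `&` dom d)) (coord d \o param c)
}.

Arguments chart {R n} m.
Arguments dom {R n m} c.
Arguments coord {R n m} c.
Arguments param {R n m} c.

Section TangentBundle.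
Context {R : realType} {n : nat} {M : manifold R n}.

(* A tangent vector is the family of its components in all charts around p,
   related by the differentials of the transition maps; components in the other
   charts are set to 0, so that they carry no information. *)
Record tangent (p : M) := Tangent {
  comp : chart M -> 'rV[R]_n;
  comp_out : forall c, ~ dom c p -> comp c = 0;
  comp_transition : forall c d, dom c p -> dom d p ->
    comp d = 'd (coord d \o param c) (coord c p) (comp c)
}.

Definition TM := {p : M & tangent p}.

Lemma tangent_ext (p : M) (v w : tangent p) (c : chart M) :
  dom c p -> comp v c = comp w c -> v = w.
Proof.
move=> pc; case: v w => [v v0 vT] [w w0 wT] /= vw.
have vwE : v = w.
  apply/funext => d; have [pd|pd] := pselect (dom d p); last by rewrite v0 ?w0.
  by rewrite (vT c d) // (wT c d) // vw.
by subst w; congr Tangent; exact: Prop_irrelevance.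
Qed.

Section Scale.
Variables (p : M) (a : R) (v : tangent p).

Fact scale_out (c : chart M) : ~ dom c p -> a *: comp v c = 0.
Proof. by move=> /(comp_out v) ->; rewrite scaler0. Qed.

Fact scale_transition (c d : chart M) : dom c p -> dom d p ->
  a *: comp v d = 'd (coord d \o param c) (coord c p) (a *: comp v c).
Proof. by move=> pc pd; rewrite linearZ (comp_transition v pc pd). Qed.

Definition tangent_scale : tangent p := Tangent scale_out scale_transition.

End Scale.

Lemma range_dom (c : chart M) x : (coord c @` dom c) x -> dom c (param c x).
Proof. by case=> p pc <-; rewrite coordK. Qed.

Lemma paramK (c : chart M) x : (coord c @` dom c) x -> coord c (param c x) = x.
Proof. by case=> p pc <-; rewrite coordK. Qed.

Lemma diff_transition (c d e : chart M) x y : (coord c @` dom c) x ->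
  dom d (param c x) -> dom e (param c x) ->
  'd (coord e \o param c) x y =
  'd (coord e \o param d) (coord d (param c x)) ('d (coord d \o param c) x y).
Proof.
move=> xc xd xe; have xc' := range_dom xc.
have diffT (c1 c2 : chart M) q : dom c1 q -> dom c2 q ->
    differentiable (coord c2 \o param c1) (coord c1 q).
  by move=> q1 q2; have [+ _] := @transition_smooth _ _ M c1 c2 1%N; apply; exists q.
have dce := diffT c e _ xc' xe; have dcd := diffT c d _ xc' xd.
have dde := diffT d e _ xd xe; rewrite (paramK xc) in dce dcd.
have dC := differentiable_comp dcd dde.
apply: etrans (congr1 (@^~ y) (diff_comp dcd dde)).
apply: etrans (esym (deriveE y dce)) _; apply: etrans _ (deriveE y dC).
have [->|y0] := eqVneq y 0; first by rewrite !derive0.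
apply: near_eq_derive => //.
have : \forall z \near x, dom d (param c z).
  apply: (param_continuous xc); apply: open_nbhs_nbhs; split => //.
  exact: dom_open.
by apply: filterS => z zd /=; rewrite coordK.
Qed.

Section TangentOf.
Variables (c : chart M) (x y : 'rV[R]_n) (xc : (coord c @` dom c) x).

Definition comp_of (d : chart M) : 'rV[R]_n :=
  if pselect (dom d (param c x)) then 'd (coord d \o param c) x y else 0.

Fact comp_of_out d : ~ dom d (param c x) -> comp_of d = 0.
Proof. by rewrite /comp_of; case: pselect. Qed.

Fact comp_of_in d : dom d (param c x) ->
  comp_of d = 'd (coord d \o param c) x y.
Proof. by rewrite /comp_of; case: pselect. Qed.

Fact comp_of_transition d e : dom d (param c x) -> dom e (param c x) ->
  comp_of e =
  'd (coord e \o param d) (coord d (param c x)) (comp_of d).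
Proof.
by move=> xd xe; rewrite (comp_of_in xd) (comp_of_in xe); exact: diff_transition.
Qed.

Definition tangent_of : tangent (param c x) :=
  Tangent comp_of_out comp_of_transition.

Lemma comp_tangent_of : comp tangent_of c = y.
Proof.
have xd := range_dom xc.
rewrite /= (comp_of_in xd).
have dxc : differentiable (coord c \o param c) x.
  rewrite -(paramK xc).
  have [+ _] := @transition_smooth _ _ M c c 1%N; apply.
  by exists (param c x).
have [->|y0] := eqVneq y 0; first by rewrite linear0.
rewrite -deriveE // (@near_eq_derive _ _ _ _ id) ?derive_id //.
have : \forall z \near x, (coord c @` dom c) z.
  by apply: open_nbhs_nbhs; split => //; exact: range_open.
by apply: filterS => z zc /=; rewrite paramK.
Qed.

End TangentOf.

(* The expression f(x, y) of f in the coordinates of TM induced by c. *)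
Definition local_expr (f : TM -> R) (c : chart M)
    (z : 'rV[R]_n * 'rV[R]_n) : R :=
  if pselect ((coord c @` dom c) z.1) is left zc
  then f (existT _ (param c z.1) (tangent_of z.2 zc)) else 0.

Lemma local_exprE (f : TM -> R) (c : chart M) (p : M) (v : tangent p) :
  dom c p -> local_expr f c (coord c p, comp v c) = f (existT _ p v).
Proof.
move=> pc; rewrite /local_expr; case: pselect => [zc|]; last by case; exists p.
congr f; have := comp_tangent_of (comp v c) zc.
move: (tangent_of _ _); rewrite /= (coordK pc) => w wv.
by congr existT; exact: tangent_ext wv.
Qed.

Definition slit_domain (c : chart M) : set ('rV[R]_n * 'rV[R]_n) :=
  [set z | (coord c @` dom c) z.1 /\ z.2 != 0].

Definition smooth_slit (f : TM -> R) : Prop :=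
  forall c, smooth_on (slit_domain c) (local_expr f c).

End TangentBundle.

Arguments TM {R n} M.

Section LocalObjects.
Context {R : realType} {n : nat}.

(* A point (x, y) of the domain of induced coordinates on TM. *)
Let E : Type := ('rV[R]_n * 'rV[R]_n)%type.

Definition dx (i : 'I_n) (f : E -> R) : E -> R := 'D_(delta_mx 0 i, 0) f.
Definition dy (a : 'I_n) (f : E -> R) : E -> R := 'D_(0, delta_mx 0 a) f.

Section Connection.
Variable F : E -> R.

Definition Fsq (z : E) : R := F z ^+ 2.

Definition metric (z : E) : 'M[R]_n :=
  \matrix_(i, j) (2^-1 * dy i (dy j Fsq) z).

Definition spray (i : 'I_n) (z : E) : R :=
  4^-1 * \sum_h invmx (metric z) i h *
    (\sum_k dy h (dx k Fsq) z * z.2 0 k - dx h Fsq z).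

Definition cartan (i j : 'I_n) : E -> R := dy j (spray i).

Definition delta (i : 'I_n) (f : E -> R) (z : E) : R :=
  dx i f z - \sum_a cartan a i z * dy a f z.

Definition chern (i j k : 'I_n) (z : E) : R :=
  2^-1 * \sum_h invmx (metric z) i h *
    (delta k (fun w => metric w h j) z + delta j (fun w => metric w h k) z
     - delta h (fun w => metric w j k) z).

(* hcov A j i is A_{j|i}. *)
Definition hcov (A : 'I_n -> E -> R) (j i : 'I_n) (z : E) : R :=
  delta i (A j) z - \sum_k chern k j i z * A k z.

End Connection.

Definition form (k : nat) : Type := E -> ('I_k -> E) -> R.

Definition wedge (alpha beta : form 1) : form 2 := fun z v =>
  alpha z (fun=> v 0) * beta z (fun=> v 1)
  - alpha z (fun=> v 1) * beta z (fun=> v 0).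

(* The invariant formula for the exterior derivative, evaluated on constant
   vector fields, so that the terms in Lie brackets vanish. *)
Definition ext_d (k : nat) (w : form k) : form k.+1 := fun z v =>
  \sum_(i < k.+1) (-1) ^+ i * 'D_(v i) (fun u => w u (fun j => v (lift i j))) z.

Definition form_dx (i : 'I_n) : form 1 := fun z v => (v 0).1 0 i.

Definition form_deltay (F : E -> R) (a : 'I_n) : form 1 := fun z v =>
  (v 0).2 0 a + \sum_i cartan F a i z * (v 0).1 0 i.

Definition potential (L1 : E -> R) (i : 'I_n) : E -> R := dy i L1.

Definition em_h (F L1 : E -> R) (i j : 'I_n) (z : E) : R :=
  hcov F (potential L1) j i z - hcov F (potential L1) i j z.

Definition em_v (L1 : E -> R) (i a : 'I_n) (z : E) : R :=
  - dy a (potential L1 i) z.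

Definition em_form (F L1 : E -> R) : form 2 := fun z v =>
  2^-1 * \sum_i \sum_j em_h F L1 i j z * wedge (form_dx i) (form_dx j) z v
  + \sum_i \sum_a em_v L1 i a z * wedge (form_dx i) (form_deltay F a) z v.

End LocalObjects.

Section PseudoFinsler.
Context {R : realType} {n : nat} (M : manifold R n).

Record pseudo_finsler (F : TM M -> R) : Prop := PseudoFinsler {
  finsler_smooth : smooth_slit F;
  finsler_homogeneous : forall (p : M) (v : tangent p) (a : R), 0 < a ->
    F (existT _ p (tangent_scale a v)) = a * F (existT _ p v);
  finsler_nondegenerate : forall (c : chart M) z, slit_domain c z ->
    metric (local_expr F c) z \in unitmx
}.

Definition homogeneous1 (L1 : TM M -> R) : Prop :=
  forall (c : chart M) z, slit_domain c z ->
    \sum_i dy i (local_expr L1 c) z * z.2 0 i = local_expr L1 c z.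

End PseudoFinsler.

(* Main.v *)
(* In coordinates F = d(A_i dx^i): since L^k_{ji} is symmetric in j, i it cancels
   from F_ij, and the terms N^a_i (dA_j/dy^a) left in F_ij cancel against those
   coming from delta y^a. Hence dF = 0 by the symmetry of second derivatives,
   which is also what makes the metric, hence L^k_{ji}, symmetric. *)
Require Import Defs.
From mathcomp Require Import all_boot all_order all_algebra.
From mathcomp Require Import all_classical all_reals all_analysis.
From mathcomp Require Import ring lra.

Import Order.TTheory GRing.Theory Num.Theory numFieldNormedType.Exports.
Local Open Scope classical_set_scope.
Local Open Scope ring_scope.

(** * Symmetry of mixed directional derivatives of class C^2 functions *)

Section MixedDerivatives.
Context {R : realType} {V : normedModType R}.
Implicit Types (f : V -> R) (z u v w : V) (U : set V).

Lemma is_derive_line f z u (s : R) : derivable f (z + s *: u) u ->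
  is_derive s 1 (fun t : R => f (z + t *: u)) ('D_u f (z + s *: u)).
Proof.
move=> fu; have quotE : (fun h : R => h^-1 *:
    (((fun t : R => f (z + t *: u)) \o shift s) (h *: 1) - f (z + s *: u))) =
    (fun h => h^-1 *: ((f \o shift (z + s *: u)) (h *: u) - f (z + s *: u))).
  apply/funext => h /=; congr (_ *: (f _ - _)).
  by rewrite [h *: 1]mulr1 scalerDl addrCA.
by apply: DeriveDef; rewrite /derivable /derive quotE.
Qed.

Lemma MVT_line f z u (h : R) : 0 < h ->
  (forall s, 0 <= s <= h -> derivable f (z + s *: u) u) ->
  exists2 s, 0 <= s <= h & f (z + h *: u) - f z = 'D_u f (z + s *: u) * h.
Proof.
pose g (t : R) : R := f (z + t *: u).
pose dg (t : R) : R := 'D_u f (z + t *: u).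
move=> h0 fu; have g' s : s \in `[0, h]%R -> is_derive s 1 g (dg s).
  by rewrite in_itv /= => /fu; exact: is_derive_line.
have gc : {within `[0, h], continuous g}.
  by apply: derivable_within_continuous => s /g' [].
have goo s : s \in `]0, h[%R -> is_derive s 1 g (dg s).
  by move=> sh; apply: g'; rewrite in_itv /= !ltW ?(itvP sh).
have [s sh gE] := MVT_segment (ltW h0) goo gc.
exists s; first by rewrite in_itv in sh.
by rewrite /g scale0r addr0 subr0 in gE.
Qed.

(** The mean value theorem is applied twice: along [u] to the increment of [f] by [h *: v], then
    along [v] to ['D_u f]. The left-hand side is symmetric in [u] and [v], the right-hand side is
    not visibly so; [derive_comm] exploits this. *)
Lemma second_difference f U z u v (h : R) : Ck_on 2 U f -> 0 < h ->
  (forall s t, 0 <= s <= h -> 0 <= t <= h -> U (z + s *: u + t *: v)) ->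
  exists s t, [/\ 0 <= s <= h, 0 <= t <= h &
    f (z + h *: u + h *: v) - f (z + h *: u) - f (z + h *: v) + f z =
    'D_v ('D_u f) (z + s *: u + t *: v) * h ^+ 2].
Proof.
move=> [fd fd2] h0 zU.
have le0h : (0 : R) <= 0 <= h by rewrite lexx ltW.
have lehh : 0 <= h <= h by rewrite lexx ltW.
have derf t s : 0 <= t <= h -> 0 <= s <= h -> derivable f (z + s *: u + t *: v) u.
  by move=> th sh; apply/diff_derivable/fd/zU.
pose g := (f \o shift (h *: v)) - f.
have gE x : g x = f (x + h *: v) - f x by [].
have dfh s : 0 <= s <= h ->
    is_derive (z + s *: u) u (f \o shift (h *: v)) ('D_u f (z + s *: u + h *: v)).
  move=> sh; have := derf h s lehh sh; rewrite /derivable /derive => fu.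
  have quotE : (fun k : R => k^-1 *: (((f \o shift (h *: v)) \o shift (z + s *: u)) (k *: u)
        - (f \o shift (h *: v)) (z + s *: u))) =
      (fun k => k^-1 *: ((f \o shift (z + s *: u + h *: v)) (k *: u)
        - f (z + s *: u + h *: v))).
    by apply/funext => k /=; rewrite !addrA.
  by apply: DeriveDef; rewrite /derivable /derive quotE.
have df0 s : 0 <= s <= h -> derivable f (z + s *: u) u.
  by move=> sh; have := derf 0 s le0h sh; rewrite scale0r addr0.
have dg s : 0 <= s <= h -> derivable g (z + s *: u) u.
  by move=> sh; apply: derivableB; [have [] := dfh s sh | exact: df0].
have [s sh gs] := MVT_line g z u h h0 dg.
have [|t th ft] := MVT_line ('D_u f) (z + s *: u) v h h0.
  by move=> t th; apply/diff_derivable; have [+ _] := fd2 u; apply; exact: zU.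
exists s, t; split => //.
move: gs; rewrite deriveB; [|by have [] := dfh s sh | exact: df0].
have [_ ->] := dfh s sh; rewrite ft !gE => gs.
by rewrite [RHS]mulrA -gs; ring.
Qed.

(** One second difference, divided by [h ^+ 2], is a value of each mixed derivative at a point near
    [z]; by continuity both derivatives at [z] are then within [e / 2] of it. *)
Lemma derive_comm f U z u v : open U -> Ck_on 2 U f -> U z ->
  'D_v ('D_u f) z = 'D_u ('D_v f) z.
Proof.
move=> Uo f2 Uz; apply/eqP; rewrite -subr_eq0 -normr_le0.
apply/ler_addgt0Pr => e e0; rewrite add0r.
have [_ fd2] := f2.
have cont a b : {for z, continuous ('D_a ('D_b f))}.
  by have [_ fc] := fd2 b; exact: fc.
have e2 : 0 < e / 2 by lra.
have near_ball (P : V -> Prop) : (\forall w \near z, P w) ->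
    exists2 d : R, 0 < d & forall w, `|z - w| < d -> P w.
  by move=> /nbhs_normP[d d0 dP]; exists d.
have close (g : V -> R) : {for z, continuous g} ->
    exists2 d : R, 0 < d & forall w, `|z - w| < d -> `|g z - g w| < e / 2.
  by move=> gc; apply: near_ball; move/cvgrPdist_lt : gc => /(_ _ e2).
have [d0 d0_gt0 d0P] : exists2 d : R, 0 < d & forall w, `|z - w| < d -> U w.
  by apply: near_ball; exact: open_nbhs_nbhs.
have [d1 d1_gt0 d1P] := close _ (cont v u).
have [d2 d2_gt0 d2P] := close _ (cont u v).
pose d := Num.min d0 (Num.min d1 d2).
have d_gt0 : 0 < d by rewrite !lt_min d0_gt0 d1_gt0.
(* With this [h] the parallelogram spanned by [h *: u] and [h *: v] at [z] stays within distance [d]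
   of [z]; the summand 1 keeps the denominator positive and the bound strict. *)
pose h := d / (`|u| + `|v| + 1).
have k0 : 0 < `|u| + `|v| + 1 by rewrite ltr_wpDl // addr_ge0.
have h0 : 0 < h by rewrite divr_gt0.
have hP s t : 0 <= s <= h -> 0 <= t <= h -> `|z - (z + s *: u + t *: v)| < d.
  move=> /andP[s0 sh] /andP[t0 th].
  rewrite opprD addrA opprD addrA subrr sub0r -opprD normrN.
  apply: le_lt_trans (ler_normD _ _) _; rewrite !normrZ !ger0_norm //.
  apply: (@le_lt_trans _ _ (h * (`|u| + `|v|))).
    by rewrite mulrDr lerD // ler_wpM2r.
  by rewrite /h mulrAC ltr_pdivrMr // ltr_pM2l // ltrDl.
have hU s t : 0 <= s <= h -> 0 <= t <= h -> U (z + s *: u + t *: v).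
  by move=> sh th; apply: d0P; have := hP s t sh th; rewrite !lt_min => /andP[].
pose D := f (z + h *: u + h *: v) - f (z + h *: u) - f (z + h *: v) + f z.
have [x zx E1] : exists2 x, `|'D_v ('D_u f) z - x| < e / 2 & D = x * h ^+ 2.
  have [|s [t [sh th E]]] := second_difference f U z u v h f2 h0.
    exact: hU.
  exists ('D_v ('D_u f) (z + s *: u + t *: v)); last exact: E.
  by apply: d1P; have := hP s t sh th; rewrite !lt_min => /and3P[].
have [y zy E2] : exists2 y, `|'D_u ('D_v f) z - y| < e / 2 & D = y * h ^+ 2.
  have [|t [s [th sh E]]] := second_difference f U z v u h f2 h0.
    by move=> t s th sh; rewrite addrAC; exact: hU.
  exists ('D_u ('D_v f) (z + s *: u + t *: v)).
    by apply: d2P; have := hP s t sh th; rewrite !lt_min => /and3P[].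
  rewrite addrAC -E /D [z + h *: v + _]addrAC; congr (_ + _); exact: addrAC.
have xy : x = y.
  by apply: (@mulIf _ (h ^+ 2)); rewrite ?expf_neq0 ?gt_eqF // -E1 -E2.
apply: le_trans (ler_distD x _ _) _; rewrite [e]splitr lerD ?ltW //.
by rewrite distrC xy.
Qed.

Lemma derive_sqr f z v : differentiable f z ->
  'D_v (fun x => f x ^+ 2) z = f z * 'D_v f z + f z * 'D_v f z.
Proof.
move=> fd; have -> : (fun x => f x ^+ 2) = f * f by apply/funext => w; rewrite expr2.
by rewrite deriveM //; exact: diff_derivable.
Qed.

(** The metric is built from second derivatives of a square, while smoothness is assumed of [f]
    itself; the product rule reduces the symmetry to that of [f]. *)
Lemma derive_comm_sqr f U z u w : open U -> Ck_on 2 U f -> U z ->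
  'D_w ('D_u (fun x => f x ^+ 2)) z = 'D_u ('D_w (fun x => f x ^+ 2)) z.
Proof.
move=> Uo f2 Uz; have [fd fd2] := f2.
have derf a : derivable f z a by apply/diff_derivable/fd.
have derf2 a b : derivable ('D_a f) z b.
  by apply/diff_derivable; have [+ _] := fd2 a; apply.
have sqrE a b : 'D_b ('D_a (fun x => f x ^+ 2)) z =
    (f z * 'D_b ('D_a f) z + 'D_a f z * 'D_b f z) *+ 2.
  (* The first derivative of the square is known only on [U], so the two functions being
     differentiated are compared near [z]. *)
  have -> : 'D_b ('D_a (fun x => f x ^+ 2)) z = 'D_b (f * 'D_a f + f * 'D_a f) z.
    apply: near_eq_derive; have : \near z, U z by exact: open_nbhs_nbhs.
    by apply: filterS => x Ux; rewrite derive_sqr //; exact: fd.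
  by rewrite deriveD ?deriveM //; exact: derivableM.
have comm := derive_comm f U z u w Uo f2 Uz.
have swap (x p q a b : R) : p = q -> (x * p + a * b) *+ 2 = (x * q + b * a) *+ 2.
  by move=> ->; rewrite [a * b]mulrC.
by apply: etrans (sqrE u w) (etrans (swap _ _ _ _ _ comm) (esym (sqrE w u))).
Qed.

End MixedDerivatives.

(** * Induced coordinates: the electromagnetic form as an exact form, and d of an exact form *)

Section Coordinates.
Context {R : realType} {n : nat}.
Let E : Type := ('rV[R]_n * 'rV[R]_n)%type.
Implicit Types (f L : E -> R) (z v w : E) (U : set E).

Lemma derive_dx f z (a : 'rV[R]_n) : differentiable f z ->
  'D_(a, 0) f z = \sum_i a 0 i * dx i f z.
Proof.
move=> fd; have aE : ((a, 0) : E) = \sum_i a 0 i *: ((delta_mx 0 i, 0) : E).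
  rewrite {1}(row_sum_delta a); elim/big_rec2: _ => // i _ y _ <-.
  by rewrite -[RHS]/(_, _) /= scaler0 addr0.
rewrite deriveE // aE linear_sum /=.
by apply: eq_bigr => i _; rewrite linearZ /= -deriveE.
Qed.

Lemma derive_dy f z (b : 'rV[R]_n) : differentiable f z ->
  'D_(0, b) f z = \sum_i b 0 i * dy i f z.
Proof.
move=> fd; have bE : ((0, b) : E) = \sum_i b 0 i *: ((0, delta_mx 0 i) : E).
  rewrite {1}(row_sum_delta b); elim/big_rec2: _ => // i _ y _ <-.
  by rewrite -[RHS]/(_, _) /= scaler0 addr0.
rewrite deriveE // bE linear_sum /=.
by apply: eq_bigr => i _; rewrite linearZ /= -deriveE.
Qed.

Lemma derive_coordinates f z v : differentiable f z ->
  'D_v f z = \sum_i v.1 0 i * dx i f z + \sum_i v.2 0 i * dy i f z.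
Proof.
move=> fd; rewrite -(derive_dx f z v.1 fd) -(derive_dy f z v.2 fd) !deriveE //.
rewrite -linearD.
by congr ('d f z _); case: v => a b; rewrite -[RHS]/(_, _) /= addr0 add0r.
Qed.

Lemma metric_sym f U z i j : open U -> Ck_on 2 U f -> U z ->
  metric f z i j = metric f z j i.
Proof.
move=> Uo f2 Uz; rewrite /metric !mxE /dy /Fsq.
by rewrite (derive_comm_sqr f U z (0, delta_mx 0 j) (0, delta_mx 0 i) Uo f2 Uz).
Qed.

Lemma chern_sym f U z i j k : open U -> Ck_on 2 U f -> U z ->
  chern f i j k z = chern f i k j z.
Proof.
move=> Uo f2 Uz; congr (_ * _); apply: eq_bigr => h _; congr (_ * _).
rewrite [X in X - _]addrC; congr (_ - _).
(* The first two terms of [chern] have been exchanged; the third needs the metric to be symmetric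
   near [z], since it is differentiated there. *)
have near_sym a : 'D_a (fun w => metric f w j k) z = 'D_a (fun w => metric f w k j) z.
  apply: near_eq_derive; have : \near z, U z by exact: open_nbhs_nbhs.
  by apply: filterS => w; exact: metric_sym f U w j k Uo f2.
rewrite /delta /dx near_sym; congr (_ - _).
by apply: eq_bigr => a _; rewrite /dy near_sym.
Qed.

(** Exchanging the derivatives allows ['D_w L] to be expanded linearly in [b]; exchanging back in
    each term produces the potentials. *)
Lemma derive_potential L U z w (b : 'rV[R]_n) : open U -> Ck_on 2 U L -> U z ->
  'D_w ('D_(0, b) L) z = \sum_j b 0 j *
    (\sum_i w.1 0 i * dx i (potential L j) z + \sum_c w.2 0 c * dy c (potential L j) z).
Proof.
move=> Uo L2 Uz; have [_ Ld2] := L2.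
have derL u : differentiable ('D_u L) z by have [+ _] := Ld2 u; apply.
rewrite (derive_comm L U z (0, b) w Uo L2 Uz).
rewrite (derive_dy ('D_w L) z b (derL w)).
apply: eq_bigr => j _; congr (_ * _).
rewrite -(derive_coordinates (potential L j) z w (derL _)).
exact: derive_comm L U z w (0, delta_mx 0 j) Uo L2 Uz.
Qed.

Lemma em_hE f L U z i j : open U -> Ck_on 2 U f -> U z ->
  em_h f L i j z = delta f i (potential L j) z - delta f j (potential L i) z.
Proof.
move=> Uo f2 Uz; rewrite /em_h /hcov.
under [X in _ - X - _]eq_bigr do rewrite (chern_sym f U z _ _ _ Uo f2 Uz).
by rewrite opprB addrA subrK.
Qed.

(** Pure algebra at one point: [X i j] and [Y c j] stand for the x- and y-derivatives of the
    potential $A_j$, [N] for the Cartan connection, and [(a, p)], [(b, q)] for the two vectors fed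
    to the form. *)
Lemma em_coordinates (X Y N : 'I_n -> 'I_n -> R) (a b p q : 'I_n -> R) :
  2^-1 * (\sum_i \sum_j ((X i j - \sum_c N c i * Y c j)
                         - (X j i - \sum_c N c j * Y c i)) * (a i * b j - b i * a j))
  + \sum_i \sum_c - Y c i * (a i * (q c + \sum_k N c k * b k)
                             - b i * (p c + \sum_k N c k * a k)) =
  \sum_j b j * (\sum_i a i * X i j + \sum_c p c * Y c j)
  - \sum_j a j * (\sum_i b i * X i j + \sum_c q c * Y c j).
Proof.
(* [H i j] stands for $\delta_i A_j$. *)
pose H i j := X i j - \sum_c N c i * Y c j.
have HE (e : 'I_n -> R) j : \sum_i e i * H i j =
    \sum_i e i * X i j - \sum_c (\sum_k N c k * e k) * Y c j.
  under eq_bigr do rewrite mulrBr.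
  rewrite sumrB; congr (_ - _); under eq_bigr do rewrite mulr_sumr.
  rewrite exchange_big /=; apply: eq_bigr => c _; rewrite mulr_suml.
  by apply: eq_bigr => k _; ring.
(* Both factors are antisymmetric, so each half contributes equally; the resulting 2 absorbs the
   [2^-1] of [em_form]. *)
have antisym : \sum_i \sum_j (H i j - H j i) * (a i * b j - b i * a j) =
    (\sum_j b j * (\sum_i a i * H i j) - \sum_j a j * (\sum_i b i * H i j)) * 2.
  have SE : \sum_i \sum_j H i j * (a i * b j - b i * a j) =
      \sum_j b j * (\sum_i a i * H i j) - \sum_j a j * (\sum_i b i * H i j).
    rewrite exchange_big -sumrB /=; apply: eq_bigr => j _.
    by rewrite !mulr_sumr -sumrB; apply: eq_bigr => i _; ring.
  rewrite -SE mulr_natr mulr2n [X in _ = _ + X]exchange_big -big_split /=.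
  apply: eq_bigr => i _; rewrite -big_split; apply: eq_bigr => j _ /=.
  by rewrite /H; ring.
rewrite [X in _ * X]antisym mulrCA mulVf ?pnatr_eq0 // mulr1.
rewrite -!sumrB -big_split /=; apply: eq_bigr => j _.
rewrite !HE; set A := fun c => \sum_k N c k * a k; set B := fun c => \sum_k N c k * b k.
(* The sums with [A] and [B] are those that [HE] subtracts, so [N] disappears. *)
have -> : \sum_c - Y c j * (a j * (q c + B c) - b j * (p c + A c)) =
    b j * (\sum_c p c * Y c j + \sum_c A c * Y c j)
    - a j * (\sum_c q c * Y c j + \sum_c B c * Y c j).
  rewrite -!big_split !mulr_sumr -sumrB /=; apply: eq_bigr => c _; ring.
ring.
Qed.

(* The value of A_i dx^i on a vector w is the derivative of L along (0, w.1). *)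
Lemma em_form_exact f L U z (v : 'I_2 -> E) : open U -> Ck_on 2 U f ->
  Ck_on 2 U L -> U z ->
  em_form f L z v = 'D_(v 0) ('D_(0, (v 1).1) L) z - 'D_(v 1) ('D_(0, (v 0).1) L) z.
Proof.
move=> Uo f2 L2 Uz; rewrite !(derive_potential L U z _ _ Uo L2 Uz).
(* Read from right to left, the identity introduces [N], which has to be supplied. *)
rewrite -(em_coordinates _ _ (fun a i => cartan f a i z)).
congr (_ * _ + _); apply: eq_bigr => i _; apply: eq_bigr => j _.
by rewrite (em_hE f L U z i j Uo f2 Uz).
Qed.

(** This is $d^2=0$: [alpha u] is a 1-form evaluated on the constant field [u], and [w] is its
    exterior derivative on [U]. The six second derivatives cancel in pairs. *)
Lemma ext_d_exact (alpha : E -> E -> R) (w : E -> ('I_2 -> E) -> R) U z (v : 'I_3 -> E) :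
  open U -> (forall u, Ck_on 2 U (alpha u)) ->
  (forall x u, U x -> w x u = 'D_(u 0) (alpha (u 1)) x - 'D_(u 1) (alpha (u 0)) x) ->
  U z -> ext_d w z v = 0.
Proof.
move=> Uo a2 wE Uz.
(* The existential makes [T] opaque, so that the second derivatives become atoms for [ring]. *)
have [T TE] : exists T : E -> E -> E -> R,
    forall p q r, 'D_p ('D_q (alpha r)) z = T p q r by eexists.
have Tsym p q r : T p q r = T q p r.
  by rewrite -!TE (derive_comm (alpha r) U z q p Uo (a2 r) Uz).
have dE (i : 'I_3) p q r : v i = p -> v (lift i 0) = q -> v (lift i 1) = r ->
    'D_(v i) (fun x => w x (fun j => v (lift i j))) z = T p q r - T p r q.
  move=> vp vq vr; rewrite -!TE -deriveB.
  - rewrite -vp; apply: near_eq_derive.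
    have : \near z, U z by exact: open_nbhs_nbhs.
    by apply: filterS => x Ux; rewrite wE // vq vr.
  - by apply: diff_derivable; have [_ /(_ q)[+ _]] := a2 r; apply.
  - by apply: diff_derivable; have [_ /(_ r)[+ _]] := a2 q; apply.
(* Indices obtained by [lift] agree with the numerals 0, 1, 2 in value only. *)
have vE (i j : 'I_3) : i = j :> nat -> v i = v j by move=> /val_inj ->.
rewrite /ext_d !big_ord_recl big_ord0.
rewrite (dE ord0 (v 0) (v 1) (v 2)); try exact: vE.
rewrite (dE (lift ord0 ord0) (v 1) (v 0) (v 2)); try exact: vE.
rewrite (dE (lift ord0 (lift ord0 ord0)) (v 2) (v 0) (v 1)); try exact: vE.
rewrite (Tsym (v 1) (v 0)) (Tsym (v 2) (v 0)) (Tsym (v 2) (v 1)) /=.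
move: (T _ _ _) (T _ _ _) (T _ _ _) => a b c.
by rewrite expr0 expr1 expr2; ring.
Qed.

End Coordinates.

(** * Openness of the slit domain, and closedness of the electromagnetic form in each chart *)

Lemma open_slit_domain (R : realType) (n : nat) (M : manifold R n) (c : chart M) :
  open (slit_domain c).
Proof.
have -> : slit_domain c = fst @^-1` (Defs.coord c @` dom c) `&` snd @^-1` (~` [set 0]).
  by apply/seteqP; split => z [zc z0]; split => //; apply/eqP.
apply: openI.
- by apply: open_comp => [z _|]; [exact: cvg_fst | exact: range_open].
- apply: open_comp => [z _|]; first exact: cvg_snd.
  rewrite openC; apply: accessible_closed_set1; apply: hausdorff_accessible.
  exact: norm_hausdorff.
Qed.

Theorem proposition8 (R : realType) (M : manifold R 4) (F L1 : TM M -> R)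
  (F_finsler : pseudo_finsler F)
  (L1_smooth : smooth_slit L1)
  (L1_homogeneous : homogeneous1 L1) :
  forall (c : chart M) (z : 'rV[R]_4 * 'rV[R]_4), slit_domain c z ->
  forall v : 'I_3 -> 'rV[R]_4 * 'rV[R]_4,
    ext_d (em_form (local_expr F c) (local_expr L1 c)) z v = 0.
Proof.
move=> c z zc v; have Uo := open_slit_domain _ _ M c.
have [Fsm _ _] := F_finsler.
(* The primitive is $A_i\,dx^i$, whose value on [w] is a first derivative of $L_1$; it is of class
   C^2 because $L_1$ is of class C^3. *)
apply: (ext_d_exact (fun w => 'D_(0, w.1) (local_expr L1 c)) _ _ _ _ Uo _ _ zc).
- by move=> w; have [_] := L1_smooth c 3%N; apply.
- by move=> x w xc; exact: em_form_exact Uo (Fsm c 2%N) (L1_smooth c 2%N) xc.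
Qed.
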